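(* Let $\mathbf A$ be a nontrivial anti-idempotent semilinear De Morgan monoid. Then the following are equivalent: (1) $\mathbf A$ is negatively generated; (2) $\mathbf A$ is isomorphic to a subdirect product of reflections $R(\mathbf D)$ of totally ordered generalized Sugihara monoids $\mathbf D$; (3) $\mathbf A$ satisfies the equation $$x=\big(d(\sigma(x))\wedge\sigma(x)\big)\vee\big(d'(\sigma'(x))\wedge\sigma'(x)\big)\vee\big((f^2\vee\neg(f^2))\to\sigma'(x)\big),$$ where $d'(x):=(f^2\to(x\cdot f))\wedge(f^2\cdot\neg x)$, $\sigma(x):=(x\wedge e)\cdot(x^*\wedge e)^*$, $d(x):=d'(\neg x)$ and $\sigma'(x):=\neg\sigma(\neg x)$.
   Context: An involutive residuated lattice (IRL) is an algebra $\langle A;\cdot,\wedge,\vee,\neg,e\rangle$ with $\langle A;\cdot,e\rangle$ a commutative monoid, $\langle A;\wedge,\vee\rangle$ a lattice (order $\leqslant$), $\neg\neg x=x$, and $x\cdot y\leqslant z\iff\neg z\cdot y\leqslant\neg x$. Define $x\to y:=\neg(x\cdot\neg y)$, $f:=\neg e$, $f^2:=f\cdot f$, $x^*:=x\to e$. A De Morgan monoid is an IRL with distributive lattice satisfying $x\leqslant x\cdot x$; it is anti-idempotent if it satisfies $x\leqslant f^2$; semilinear if isomorphic to a subdirect product of totally ordered algebras; negatively generated if generated by $\{a: a\leqslant e\}$. A (commutative) residuated lattice (RL) is $\langle A;\cdot,\to,\wedge,\vee,e\rangle$ with commutative monoid, lattice and $x\cdot y\leqslant z\iff y\leqslant x\to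 z$; a Dunn monoid is a distributive RL satisfying $x\leqslant x\cdot x$; a generalized Sugihara monoid is an RL isomorphic to a subdirect product of totally ordered RLs, with $a\cdot a=a$ for all $a$, satisfying $(x\vee e)^{**}=x\vee e$. Reflection: for a Dunn monoid $\mathbf D$, take a disjoint copy $D'=\{a':a\in D\}$ and new elements $0,1$; $R(\mathbf D)$ is the De Morgan monoid on $D\cup D'\cup\{0,1\}$ such that $\mathbf D$ is a subalgebra of its RL-reduct and, for $a,b\in D$ and $x\in R(D)$: $0<a<b'<1$; $a'\leqslant b'$ iff $b\leqslant a$; $x\cdot 0=0$; $a'\cdot b'=1$; $x\cdot 1=1$ if $x\neq 0$; $a\cdot b'=(a\to b)'$; $\neg a=a'$, $\neg(a')=a$, $\neg0=1$, $\neg1=0$. *)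

(* Defs.v *)
From mathcomp Require Import ssreflect ssrfun ssrbool.

Set Implicit Arguments.
Unset Strict Implicit.
Unset Printing Implicit Defensive.

Declare Scope alg_scope.
Delimit Scope alg_scope with A.
Local Open Scope alg_scope.

(* The part [mul, meet, join, e] of the signature that is common to IRLs and
   RLs. *)
Record latMonoid := LatMonoid {
  carrier :> Type;
  mul : carrier -> carrier -> carrier;
  meet : carrier -> carrier -> carrier;
  join : carrier -> carrier -> carrier;
  one : carrier;
  mulA : associative mul;
  mulC : commutative mul;
  mul1 : left_id one mul;
  meetA : associative meet;
  meetC : commutative meet;
  joinA : associative join;
  joinC : commutative join;
  meetKj : forall x y, meet x (join x y) = x;
  joinKm : forall x y, join x (meet x y) = x
}.
Arguments one {_}.

Definition le (L : latMonoid) (x y : L) : Prop := meet x y = x.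

Notation "x · y" := (mul x y) (at level 40, left associativity) : alg_scope.
Notation "x ∧ y" := (meet x y) (at level 45, left associativity) : alg_scope.
Notation "x ∨ y" := (join x y) (at level 50, left associativity) : alg_scope.
Notation "x ≤ y" := (le x y) (at level 70, no associativity) : alg_scope.
Notation "'𝐞'" := one (at level 0) : alg_scope.

Definition nontrivial (L : latMonoid) : Prop := exists x y : L, x <> y.
Definition totally_ordered (L : latMonoid) : Prop :=
  forall x y : L, x ≤ y \/ y ≤ x.
Definition distributive (L : latMonoid) : Prop :=
  forall x y z : L, x ∧ (y ∨ z) = (x ∧ y) ∨ (x ∧ z).
Definition square_increasing (L : latMonoid) : Prop :=
  forall x : L, x ≤ x · x.
Definition idempotent (L : latMonoid) : Prop := forall x : L, x · x = x.

Definition lat_morphism (L M : latMonoid) (h : L -> M) : Prop :=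
  [/\ {morph h : x y / x · y}, {morph h : x y / x ∧ y},
      {morph h : x y / x ∨ y} & h 𝐞 = 𝐞].

Record IRL := MkIRL {
  irl_lat :> latMonoid;
  neg : irl_lat -> irl_lat;
  negK : involutive neg;
  negP : forall x y z : irl_lat, x · y ≤ z <-> neg z · y ≤ neg x
}.

Record RL := MkRL {
  rl_lat :> latMonoid;
  res : rl_lat -> rl_lat -> rl_lat;
  resP : forall x y z : rl_lat, x · y ≤ z <-> y ≤ res x z
}.

Notation "¬ x" := (neg x) (at level 35, right associativity) : alg_scope.
Notation "x ⇒ y" := (res x y)
  (at level 55, right associativity) : alg_scope.

Definition irl_morphism (A B : IRL) (h : A -> B) : Prop :=
  lat_morphism h /\ {morph h : x / ¬ x}.
Definition rl_morphism (A B : RL) (h : A -> B) : Prop :=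
  lat_morphism h /\ {morph h : x y / x ⇒ y}.

(* [A] embeds in the product of the family [B], all of whose members lie in
   [K], and the projections of the image of [A] are onto.  The operations of
   the product are pointwise, so [h] is a homomorphism into the product if and
   only if each of its components is one. *)
Definition irl_subdirect (K : IRL -> Prop) (A : IRL) : Prop :=
  exists (I : Type) (B : I -> IRL) (h : A -> forall i, B i),
    [/\ forall i, K (B i), injective h,
        forall i, irl_morphism (fun x => h x i)
      & forall i (b : B i), exists x, h x i = b].
Definition rl_subdirect (K : RL -> Prop) (A : RL) : Prop :=
  exists (I : Type) (B : I -> RL) (h : A -> forall i, B i),
    [/\ forall i, K (B i), injective h,
        forall i, rl_morphism (fun x => h x i)
      & forall i (b : B i), exists x, h x i = b].

Definition irl_semilinear (A : IRL) : Prop :=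
  irl_subdirect (fun B => totally_ordered B) A.
Definition rl_semilinear (A : RL) : Prop :=
  rl_subdirect (fun B => totally_ordered B) A.

Section IRLterms.
Variable A : IRL.
Implicit Types x y : A.

Definition imp x y : A := ¬ (x · ¬ y).
Definition ff : A := ¬ 𝐞.
Definition ff2 : A := ff · ff.
Definition star x : A := imp x 𝐞.

Definition sigma x : A := (x ∧ 𝐞) · star (star x ∧ 𝐞).
Definition sigma' x : A := ¬ sigma (¬ x).
Definition d' x : A := imp ff2 (x · ff) ∧ (ff2 · ¬ x).
Definition d x : A := d' (¬ x).
End IRLterms.
Arguments ff {A}.
Arguments ff2 {A}.

Definition De_Morgan_monoid (A : IRL) : Prop :=
  distributive A /\ square_increasing A.
Definition anti_idempotent (A : IRL) : Prop := forall x : A, x ≤ ff2.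

Definition subuniverse (A : IRL) (S : A -> Prop) : Prop :=
  [/\ forall x y, S x -> S y -> S (x · y),
      forall x y, S x -> S y -> S (x ∧ y),
      forall x y, S x -> S y -> S (x ∨ y),
      forall x, S x -> S (¬ x)
    & S 𝐞].
Definition generated_by (A : IRL) (X : A -> Prop) : Prop :=
  forall S : A -> Prop, subuniverse S -> (forall x, X x -> S x) ->
  forall x, S x.
Definition negatively_generated (A : IRL) : Prop :=
  generated_by (fun a : A => a ≤ 𝐞).

Definition Dunn_monoid (D : RL) : Prop :=
  distributive D /\ square_increasing D.

Definition rl_star (D : RL) (x : D) : D := x ⇒ 𝐞.

Definition generalized_Sugihara_monoid (D : RL) : Prop :=
  [/\ rl_semilinear D, idempotent D
    & forall x : D, rl_star (rl_star (x ∨ 𝐞)) = x ∨ 𝐞].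

Section LatFacts.
Variable L : latMonoid.
Implicit Types x y z : L.

Lemma meetxx x : x ∧ x = x.
Proof. by rewrite -{2}(joinKm x x) meetKj. Qed.

Lemma joinxx x : x ∨ x = x.
Proof. by rewrite -{2}(meetKj x x) joinKm. Qed.

Lemma lexx x : x ≤ x. Proof. exact: meetxx. Qed.

Lemma le_anti x y : x ≤ y -> y ≤ x -> x = y.
Proof. by rewrite /le => xy yx; rewrite -xy meetC. Qed.

Lemma le_tr y x z : x ≤ y -> y ≤ z -> x ≤ z.
Proof. by rewrite /le => xy yz; rewrite -xy -meetA yz. Qed.

Lemma leEjoin x y : x ≤ y <-> x ∨ y = y.
Proof.
rewrite /le; split=> [<-|<-]; last exact: meetKj.
by rewrite joinC (meetC x) joinKm.
Qed.
End LatFacts.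

Section Reflection.
Variable D : RL.

(* [Rin a] is [a] itself, [Rpr a] is its copy [a']. *)
Inductive refl_carrier : Type :=
  | Rbot | Rtop | Rin of D | Rpr of D.

Definition refl_mul (x y : refl_carrier) : refl_carrier :=
  match x, y with
  | Rbot, _ | _, Rbot => Rbot
  | Rtop, _ | _, Rtop => Rtop
  | Rin a, Rin b => Rin (a · b)
  | Rin a, Rpr b | Rpr b, Rin a => Rpr (a ⇒ b)
  | Rpr _, Rpr _ => Rtop
  end.

Definition refl_meet (x y : refl_carrier) : refl_carrier :=
  match x, y with
  | Rbot, _ | _, Rbot => Rbot
  | Rtop, z | z, Rtop => z
  | Rin a, Rin b => Rin (a ∧ b)
  | Rin a, Rpr _ | Rpr _, Rin a => Rin a
  | Rpr a, Rpr b => Rpr (a ∨ b)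
  end.

Definition refl_join (x y : refl_carrier) : refl_carrier :=
  match x, y with
  | Rtop, _ | _, Rtop => Rtop
  | Rbot, z | z, Rbot => z
  | Rin a, Rin b => Rin (a ∨ b)
  | Rin _, Rpr b | Rpr b, Rin _ => Rpr b
  | Rpr a, Rpr b => Rpr (a ∧ b)
  end.

Definition refl_neg (x : refl_carrier) : refl_carrier :=
  match x with
  | Rbot => Rtop
  | Rtop => Rbot
  | Rin a => Rpr a
  | Rpr a => Rin a
  end.

Lemma res_curry (a b c : D) : (a · b) ⇒ c = a ⇒ (b ⇒ c).
Proof.
apply: le_anti; last first.
  apply/resP; rewrite (mulC a) -mulA; apply/resP.
  by have /resP := lexx (a ⇒ (b ⇒ c)).
have /resP := lexx ((a · b) ⇒ c).
by rewrite (mulC a) -mulA => /resP /resP.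
Qed.

Lemma res1 (a : D) : 𝐞 ⇒ a = a.
Proof.
apply: le_anti; last by apply/resP; rewrite mul1; apply: lexx.
by have /resP := lexx (𝐞 ⇒ a); rewrite mul1.
Qed.

Fact refl_mulA : associative refl_mul.
Proof.
case=> [||a|a] [||b|b] [||c|c] //=; rewrite ?mulA -?res_curry //;
  by rewrite (mulC c).
Qed.

Fact refl_mulC : commutative refl_mul.
Proof. by case=> [||a|a] [||b|b] //=; rewrite mulC. Qed.

Fact refl_mul1 : left_id (Rin 𝐞) refl_mul.
Proof. by case=> [||a|a] //=; rewrite ?mul1 ?res1. Qed.

Fact refl_meetA : associative refl_meet.
Proof. by case=> [||a|a] [||b|b] [||c|c] //=; rewrite ?meetA ?joinA. Qed.

Fact refl_meetC : commutative refl_meet.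
Proof. by case=> [||a|a] [||b|b] //=; rewrite 1?meetC 1?joinC. Qed.

Fact refl_joinA : associative refl_join.
Proof. by case=> [||a|a] [||b|b] [||c|c] //=; rewrite ?meetA ?joinA. Qed.

Fact refl_joinC : commutative refl_join.
Proof. by case=> [||a|a] [||b|b] //=; rewrite 1?meetC 1?joinC. Qed.

Fact refl_meetKj x y : refl_meet x (refl_join x y) = x.
Proof.
by case: x y => [||a|a] [||b|b] //=; rewrite ?meetKj ?joinKm ?meetxx ?joinxx.
Qed.

Fact refl_joinKm x y : refl_join x (refl_meet x y) = x.
Proof.
by case: x y => [||a|a] [||b|b] //=; rewrite ?meetKj ?joinKm ?meetxx ?joinxx.
Qed.

Definition refl_lat : latMonoid :=
  LatMonoid refl_mulA refl_mulC refl_mul1 refl_meetA refl_meetC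
    refl_joinA refl_joinC refl_meetKj refl_joinKm.

Fact refl_negK : involutive refl_neg.
Proof. by case. Qed.

Lemma refl_le_in (a b : D) : @le refl_lat (Rin a) (Rin b) <-> a ≤ b.
Proof. by rewrite /le /=; split=> [[]|->]. Qed.

Lemma refl_le_pr (a b : D) : @le refl_lat (Rpr a) (Rpr b) <-> b ≤ a.
Proof.
apply: iff_trans (iff_sym (leEjoin b a)); rewrite joinC /le /=.
by split=> [[]|->].
Qed.

Fact refl_negP (x y z : refl_lat) :
  x · y ≤ z <-> @mul refl_lat (refl_neg z) y ≤ refl_neg x.
Proof.
case: x y z => [||a|a] [||b|b] [||c|c] //=.
- apply: iff_trans (refl_le_in _ _) (iff_trans _ (iff_sym (refl_le_pr _ _))).
  by rewrite mulC; apply: resP.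
- apply: iff_trans (refl_le_pr _ _) (iff_trans _ (iff_sym (refl_le_pr _ _))).
  by apply: iff_trans (iff_sym (resP _ _ _)) _; rewrite mulC; apply: resP.
- apply: iff_trans (refl_le_pr _ _) (iff_trans _ (iff_sym (refl_le_in _ _))).
  by rewrite mulC; apply: iff_sym; apply: resP.
Qed.

Definition reflection : IRL := @MkIRL refl_lat refl_neg refl_negK refl_negP.

Lemma reflection_order (a b : D) :
  [/\ (Rbot : reflection) ≤ Rin a, (Rin a : reflection) ≤ Rpr b
    & (Rpr b : reflection) ≤ Rtop].
Proof. by []. Qed.

(* [D] is a subalgebra of the RL-reduct of its reflection. *)
Lemma reflection_imp (a b : D) :
  @imp reflection (Rin a) (Rin b) = Rin (a ⇒ b).
Proof. by []. Qed.

Lemma reflection_De_Morgan : Dunn_monoid D -> De_Morgan_monoid reflection.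
Proof.
move=> [dD sD]; split; last by case=> [||a|a] //; apply/refl_le_in.
have dD' (x y z : D) : x ∨ (y ∧ z) = (x ∨ y) ∧ (x ∨ z).
  rewrite dD (meetC _ x) meetKj (meetC (x ∨ y) z) dD joinA.
  by rewrite (meetC z x) joinKm (meetC z).
by case=> [||a|a] [||b|b] [||c|c] //=;
  first [by rewrite dD' | by rewrite ?joinxx ?meetxx ?joinKm ?meetKj
        | by rewrite joinC joinKm | by rewrite meetC meetKj | by rewrite dD].
Qed.

End Reflection.

Definition refl_of_GSM_chain (B : IRL) : Prop :=
  exists D : RL, [/\ generalized_Sugihara_monoid D, totally_ordered D
                   & B = reflection D].

(* Main.v *)
From mathcomp Require Import ssreflect ssrfun ssrbool.
From Stdlib Require Import Classical ClassicalEpsilon FunctionalExtensionality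
  ProofIrrelevance.
Require Import Defs.

Set Implicit Arguments.
Unset Strict Implicit.
Unset Printing Implicit Defensive.
Local Open Scope alg_scope.

(** Let [B] be a nontrivial totally ordered factor of [A].  Then [𝐞 < f], and
    [f² · x = f²] unless [x] is the least element [⊥ = ¬ f²].  The elements
    [a] with [a ≠ ⊥ ≠ a*] form a subalgebra of the RL-reduct which lies below
    its own negation, and inside it the idempotent [a] with [a = a** ] whenever
    [𝐞 ≤ a] form a generalized Sugihara chain [D] containing every negative
    element other than [⊥].  The obvious map from [R(D)] to [B] is an injective
    homomorphism; its image is a subuniverse containing the negative elements,
    so it is an isomorphism as soon as [B] is negatively generated.
    Conversely, the equation (3) can be evaluated in [R(D)], where [σ] is the
    identity on [D], [d] and [d'] are the indicators of [D] and [D'], and its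
    last joinand accounts for the greatest element; its right-hand side is
    visibly a term in negative elements. *)

(** * Lattice order and chains *)

Section LatMonoidFacts.
Variable L : latMonoid.
Implicit Types x y : L.

Lemma mulr1 x : x · 𝐞 = x. Proof. by rewrite mulC mul1. Qed.

Lemma mulACA : interchange (@mul L) (@mul L).
Proof. by move=> x y z t; rewrite -!mulA (mulA y) (mulC y) mulA -!mulA. Qed.

Lemma leIr x y : x ∧ y ≤ y.
Proof. by rewrite /le -meetA meetxx. Qed.

Lemma leUr x y : y ≤ x ∨ y.
Proof. by rewrite /le joinC meetKj. Qed.

Lemma le_meet x y : x ≤ y -> (x ∧ y = x) * (y ∧ x = x).
Proof. by rewrite /le => xy; rewrite (meetC y). Qed.

Lemma le_join x y : x ≤ y -> (x ∨ y = y) * (y ∨ x = y).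
Proof. by move/leEjoin=> xy; rewrite (joinC y). Qed.

Hypothesis tot : totally_ordered L.

Lemma nle_le x y : ~ x ≤ y -> y ≤ x.
Proof. by case: (tot x y). Qed.

Lemma chain_meet x y : x ∧ y = x \/ x ∧ y = y.
Proof. by case: (tot x y) => /le_meet ->; [left | right]. Qed.

Lemma chain_join x y : x ∨ y = x \/ x ∨ y = y.
Proof. by case: (tot x y) => /le_join ->; [right | left]. Qed.

End LatMonoidFacts.

(** * Residuation and the operation [rl_star] *)

Section RLFacts.
Variable D : RL.
Implicit Types a b c : D.

Lemma le_mul2l c a b : a ≤ b -> c · a ≤ c · b.
Proof. by move=> ab; apply/resP; apply: le_tr ab _; apply/resP/lexx. Qed.

Lemma le_mul a b c c' : a ≤ b -> c ≤ c' -> a · c ≤ b · c'.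
Proof.
move=> ab cc; apply: le_tr (le_mul2l a cc) _.
by rewrite !(mulC _ c'); apply: le_mul2l.
Qed.

Lemma res_mp a b : a · (a ⇒ b) ≤ b.
Proof. exact/resP/lexx. Qed.

Lemma le_res2r a b c : a ≤ b -> b ⇒ c ≤ a ⇒ c.
Proof.
by move=> ab; apply/resP/(le_tr (le_mul ab (lexx _)))/res_mp.
Qed.

Lemma star_one : rl_star (𝐞 : D) = 𝐞. Proof. exact: res1. Qed.

Lemma le_star a b : a ≤ b -> rl_star b ≤ rl_star a.
Proof. exact: le_res2r. Qed.

Lemma star_le1 a : 𝐞 ≤ a -> rl_star a ≤ 𝐞.
Proof. by move/le_star; rewrite star_one. Qed.

Lemma star_ge1 a : a ≤ 𝐞 -> 𝐞 ≤ rl_star a.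
Proof. by move/le_star; rewrite star_one. Qed.

Lemma le_starstar a : a ≤ rl_star (rl_star a).
Proof. by apply/resP; rewrite mulC; apply: res_mp. Qed.

Lemma star3 a : rl_star (rl_star (rl_star a)) = rl_star a.
Proof. exact: le_anti (le_star (le_starstar a)) (le_starstar _). Qed.

Lemma starM a b : rl_star (a · b) = a ⇒ rl_star b.
Proof. exact: res_curry. Qed.

End RLFacts.

(** * Sugihara elements of a square-increasing chain *)

Section SugiharaElements.
Variable D : RL.
Hypotheses (tot : totally_ordered D) (sqi : square_increasing D).
Implicit Types a b : D.

(** An elementwise form of the generalized Sugihara laws on a chain: [x ∨ 𝐞] is [𝐞] or [x], and for
    [𝐞] the double-star law is automatic. *)
Definition sugihara a : Prop :=
  a · a = a /\ (𝐞 ≤ a -> rl_star (rl_star a) = a).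

Lemma negative_idem a : a ≤ 𝐞 -> a · a = a.
Proof.
by move=> a1; apply: le_anti (sqi a); move: (le_mul2l a a1); rewrite mulr1.
Qed.

Lemma sugihara_negative a : a ≤ 𝐞 -> sugihara a.
Proof.
move=> a1; split=> [|ge1]; first exact: negative_idem.
by rewrite (le_anti a1 ge1) !star_one.
Qed.

(** Compare [a · b] with [𝐞]. If it is below, multiplying by [a] gives [a · b ≤ a]; if it is above,
    multiplying by [b] gives [b ≤ a · b]. Monotonicity and idempotence give the converse
    inequalities. *)
Lemma mul_chain_aux a b :
  a · a = a -> b · b = b -> a ≤ b -> a · b = a \/ a · b = b.
Proof.
move=> aa bb ab; case: (tot (a · b) 𝐞) => h; [left | right].
  apply: le_anti; last by move: (le_mul2l a ab); rewrite aa.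
  by move: (le_mul2l a h); rewrite mulA aa mulr1.
apply: le_anti; first by move: (le_mul2l b ab); rewrite bb mulC.
by move: (le_mul2l b h); rewrite mulr1 (mulC a) mulA bb.
Qed.

Lemma mul_chain a b :
  a · a = a -> b · b = b -> a · b = a \/ a · b = b.
Proof.
move=> aa bb; case: (tot a b) => h; first exact: mul_chain_aux.
by rewrite mulC or_comm; apply: mul_chain_aux.
Qed.

Lemma star_idem a : a · a = a -> rl_star a · rl_star a = rl_star a.
Proof.
move=> aa; apply: le_anti (sqi _); apply/(resP a).
have -> : a · (rl_star a · rl_star a) = (a · rl_star a) · (a · rl_star a).
  by rewrite mulACA aa.
by rewrite -[X in _ ≤ X]mul1; apply: le_mul; apply: res_mp.
Qed.

Lemma sugihara_star a : a · a = a -> sugihara (rl_star a).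
Proof. by move=> aa; split=> [|_]; [apply: star_idem | apply: star3]. Qed.

Lemma sugihara_mul a b : sugihara a -> sugihara b -> sugihara (a · b).
Proof.
by move=> sa sb; case: (@mul_chain a b (proj1 sa) (proj1 sb)) => ->.
Qed.

(** Both [a] and [rl_star a] are idempotent, so their product is one of them. If it is [a], it lies
    below [b]; if it is [rl_star a], then [rl_star a ≤ 𝐞 ≤ a ⇒ b]. *)
Lemma res_negative a b : a ≤ b -> b ≤ 𝐞 -> a ⇒ b = rl_star a.
Proof.
move=> ab b1; have aa := negative_idem (le_tr ab b1).
have ale : a ⇒ b ≤ rl_star a.
  by apply/resP; apply: le_tr (res_mp _ _) b1.
apply: le_anti ale _; case: (mul_chain aa (star_idem aa)) => h.
  by apply/resP; rewrite h.
apply: (@le_tr _ 𝐞); first by rewrite -h; apply: res_mp.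
by apply/resP; rewrite mulr1.
Qed.

(** Unless [a ⇒ b] is negative, it is the star of an idempotent: of [a] when [b ≤ 𝐞], and of
    [a · rl_star b] when [b] equals its double star. *)
Lemma sugihara_res a b : sugihara a -> sugihara b -> sugihara (a ⇒ b).
Proof.
move=> [aa _] [bb bs]; case: (tot (a ⇒ b) 𝐞) => [|ge1].
  exact: sugihara_negative.
have ab : a ≤ b by move/resP: ge1; rewrite mulr1.
case: (tot b 𝐞) => [b1|b1].
  by rewrite res_negative //; apply: sugihara_star.
rewrite -(bs b1) -starM; apply: sugihara_star.
by case: (mul_chain aa (star_idem bb)) => ->; rewrite ?aa ?star_idem.
Qed.

End SugiharaElements.

Lemma chain_rl_semilinear (D : RL) : totally_ordered D -> rl_semilinear D.
Proof.
move=> tot; exists unit, (fun=> D), (fun x _ => x); split=> //.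
- by move=> x y /(congr1 (@^~ tt)).
- by move=> _ b; exists b.
Qed.

(** * Subalgebras of a residuated lattice *)

Section SubRL.
Variables (D : RL) (P : D -> Prop).
Hypotheses (PM : forall a b, P a -> P b -> P (a · b))
  (PI : forall a b, P a -> P b -> P (a ∧ b))
  (PU : forall a b, P a -> P b -> P (a ∨ b))
  (PR : forall a b, P a -> P b -> P (a ⇒ b)) (P1 : P 𝐞).

Let T := {a : D | P a}.
Let sub_op (op : D -> D -> D) (Pop : forall a b, P a -> P b -> P (op a b))
  (x y : T) : T := exist _ (op (sval x) (sval y)) (Pop _ _ (svalP x) (svalP y)).

Lemma sval_inj : injective (sval : T -> D).
Proof.
by move=> [x hx] [y hy] /= xy; subst y; rewrite (proof_irrelevance _ hx hy).
Qed.

Definition sub_lat : latMonoid.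
Proof.
apply: (@LatMonoid T (sub_op PM) (sub_op PI) (sub_op PU) (exist _ _ P1));
  repeat move=> ?; apply: sval_inj => /=.
- exact: mulA.
- exact: mulC.
- exact: mul1.
- exact: meetA.
- exact: meetC.
- exact: joinA.
- exact: joinC.
- exact: meetKj.
- exact: joinKm.
Defined.

Lemma sub_le (x y : sub_lat) : x ≤ y <-> sval x ≤ sval y.
Proof. by split=> [/(congr1 sval)|h] //; apply: sval_inj. Qed.

Fact sub_resP (x y z : sub_lat) : x · y ≤ z <-> y ≤ (sub_op PR x z : sub_lat).
Proof.
split=> /sub_le h; apply/sub_le; first exact: (proj1 (resP _ _ _) h).
exact: (proj2 (resP _ _ _) h).
Qed.

Definition sub_rl : RL := MkRL sub_resP.

Lemma sub_totally_ordered : totally_ordered D -> totally_ordered sub_rl.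
Proof.
by move=> tot x y; case: (tot (sval x) (sval y)) => h; [left | right];
   apply/sub_le.
Qed.

End SubRL.

(** * Residuation and negation in an IRL *)

Section IRLFacts.
Variable A : IRL.
Implicit Types x y z : A.

Lemma impP x y z : x · y ≤ z <-> y ≤ imp x z.
Proof.
apply: (iff_trans (negP x y z)); rewrite mulC.
apply: (iff_trans (negP y (¬ z) (¬ x))); rewrite negK.
have := negP (x · ¬ z) 𝐞 (¬ y); rewrite negK !mulr1; exact.
Qed.

(** Makes the residuation lemmas available in an IRL, with [imp] as the residual and [star]
    convertible to [rl_star]. *)
Definition irl_rl : RL := MkRL impP.

Lemma le_neg x y : x ≤ y -> ¬ y ≤ ¬ x.
Proof. by have /proj1 := negP x 𝐞 y; rewrite !mulr1. Qed.

Lemma le_negr x y : x ≤ ¬ y -> y ≤ ¬ x.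
Proof. by move/le_neg; rewrite negK. Qed.

Lemma neg_inj : injective (@neg A). Proof. exact: inv_inj (@negK A). Qed.

Lemma mul_neg_le x y : x · ¬ y ≤ ff <-> x ≤ y.
Proof. by rewrite mulC; have := negP (¬ y) x ff; rewrite /ff !negK mul1. Qed.

Lemma mul_le_ff x y : x · y ≤ ff <-> x ≤ ¬ y.
Proof. by rewrite -{1}(negK y) mul_neg_le. Qed.

End IRLFacts.

(** * Nontrivial anti-idempotent chains *)

Section Chain.
Variable B : IRL.
Hypotheses (tot : totally_ordered B) (sqi : square_increasing B)
  (hai : anti_idempotent B) (hnt : nontrivial B).
Implicit Types x y a b c : B.

Local Notation "⊤" := (@ff2 B).
Local Notation "⊥" := (¬ (@ff2 B)).
Local Notation D0 := (irl_rl B).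

(** Otherwise [ff2 ≤ ff ≤ 𝐞], so every element lies below [ff] and, by negation, above it, which
    makes the algebra trivial. *)
Lemma ff_nle1 : ~ (ff : B) ≤ 𝐞.
Proof.
move=> f1; have topf : ⊤ ≤ ff.
  by rewrite -[X in _ ≤ X]mulr1; apply: (@le_mul2l D0).
have all_ff x : x = ff.
  apply: le_anti (le_tr (hai x) topf) _.
  by rewrite -(negK x); apply: le_neg; apply: le_tr (hai _) (le_tr topf f1).
by case: hnt => x [y []]; rewrite (all_ff x) (all_ff y).
Qed.

Lemma le1ff : 𝐞 ≤ (ff : B). Proof. exact: nle_le ff_nle1. Qed.

Lemma top_nle_ff : ~ ⊤ ≤ ff.
Proof. by move/mul_le_ff; rewrite /ff negK; apply: ff_nle1. Qed.

Lemma top_leE x : ⊤ ≤ x -> x = ⊤.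
Proof. exact: le_anti (hai x). Qed.

Lemma bot_le x : ⊥ ≤ x.
Proof. by rewrite -(negK x); apply: le_neg. Qed.

Lemma le_botE x : x ≤ ⊥ -> x = ⊥.
Proof. by move=> h; apply: le_anti h _; apply: bot_le. Qed.

Lemma mul_bot x : ⊥ · x = ⊥.
Proof. by apply: le_botE; apply: (proj1 (negP ff2 x ff2)); apply: hai. Qed.

(** Since [⊤ · x ≤ ff] would mean [x ≤ ⊥], the chain gives [𝐞 ≤ ff ≤ ⊤ · x]. Multiplying by [⊤] and
    using [⊤ · ⊤ ≤ ⊤] gives [⊤ ≤ ⊤ · x]. *)
Lemma mul_top x : x <> ⊥ -> ⊤ · x = ⊤.
Proof.
move=> x0; apply: top_leE.
have h : 𝐞 ≤ ⊤ · x.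
  apply: le_tr le1ff _; apply: nle_le => // h; apply/x0/le_botE.
  by apply/mul_le_ff; rewrite mulC.
have := @le_mul2l D0 ⊤ _ _ h; rewrite mulr1 mulA => /le_tr; apply.
by apply: (@le_mul D0) (lexx x); apply: hai.
Qed.

Lemma top_neq_bot : ⊤ <> ⊥.
Proof. by move=> h; apply: top_nle_ff; rewrite h; apply: bot_le. Qed.

Lemma mul_neq_bot x y : x <> ⊥ -> y <> ⊥ -> x · y <> ⊥.
Proof.
move=> x0 y0 xy; apply: top_neq_bot.
by rewrite -{1}(mul_top y0) -{1}(mul_top x0) -mulA xy mulC mul_bot.
Qed.

Lemma neq_bot_le x y : x <> ⊥ -> x ≤ y -> y <> ⊥.
Proof. by move=> x0 + y0; rewrite y0 => /le_botE. Qed.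

(** If [ff ≤ a], then [a · ff] is [⊤], and [star a] is its negation. *)
Lemma star_neq_bot_le_ff a : star a <> ⊥ -> a ≤ ff.
Proof.
move=> a0; apply: nle_le => // fa; apply: a0; congr (¬ _); apply: top_leE.
exact: (@le_mul D0) fa (lexx _).
Qed.

(* The product [c] of [b*] and [(¬b)*] satisfies [c · f ≤ b] and
   [c · f ≤ ¬ b], so if it were not [⊥] then [f² = c² · f² ≤ b · ¬ b ≤ f]. *)
Lemma star_neg_bot b : star b <> ⊥ -> star (¬ b) = ⊥.
Proof.
move=> b0; apply: NNPP => nb0.
have lebf := star_neq_bot_le_ff b0; have lenbf := star_neq_bot_le_ff nb0.
have ge1 : 𝐞 ≤ b by rewrite -(negK b); apply: le_negr.
have nge1 : 𝐞 ≤ ¬ b by apply: le_negr.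
have c0 := mul_neq_bot b0 nb0; set c := _ · _ in c0.
have cb : b · c ≤ 𝐞.
  rewrite mulA -[X in _ ≤ X]mul1; apply: (@le_mul D0); first exact: (@res_mp D0).
  exact: (@star_le1 D0).
have cnb : ¬ b · c ≤ 𝐞.
  rewrite /c (mulC (star b)) mulA -[X in _ ≤ X]mul1; apply: (@le_mul D0).
    exact: (@res_mp D0).
  exact: (@star_le1 D0).
have /negP fc := cb; have /negP fnc := cnb.
apply: top_nle_ff; rewrite -(mul_top (mul_neq_bot c0 c0)).
apply: le_tr (_ : ¬ b · b ≤ ff); last by apply/mul_le_ff/lexx.
by rewrite mulACA; apply: (@le_mul D0) => //; rewrite negK in fnc.
Qed.

(** In a reflection this condition singles out the copy of [D], since [star] sends every [Rpr b] and
    [Rtop] to [Rbot]. *)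
Definition core a : Prop := a <> ⊥ /\ star a <> ⊥.

Lemma core_mul a b : core a -> core b -> core (a · b).
Proof.
move=> [a0 sa0] [b0 sb0]; split; first exact: mul_neq_bot.
apply: neq_bot_le (mul_neq_bot sa0 sb0) _; apply/(impP (a · b)).
rewrite mulACA -[X in _ ≤ X]mul1.
by apply: (@le_mul D0); apply: (@res_mp D0).
Qed.

(** Products of elements other than [⊥] serve as lower bounds: [star a · b ≤ imp a b] and
    [a · star b ≤ star (imp a b)]. *)
Lemma core_imp a b : core a -> core b -> core (imp a b).
Proof.
move=> [a0 sa0] [b0 sb0]; split.
  apply: neq_bot_le (mul_neq_bot sa0 b0) _; apply/(impP a).
  rewrite mulA -[X in _ ≤ X]mul1.
  by apply: (@le_mul D0) (lexx _); apply: (@res_mp D0).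
apply: neq_bot_le (mul_neq_bot a0 sb0) _; apply/(impP (imp a b)).
rewrite mulA (mulC _ a); apply: le_tr (@res_mp D0 b 𝐞).
by apply: (@le_mul D0) (lexx _); apply: (@res_mp D0).
Qed.

Lemma one_neq_bot : (𝐞 : B) <> ⊥.
Proof.
move=> h; apply: top_neq_bot.
by rewrite -[LHS]mulr1 h mulC mul_bot.
Qed.

Lemma core_negative a : a <> ⊥ -> a ≤ 𝐞 -> core a.
Proof.
move=> a0 a1; split=> //; apply: neq_bot_le one_neq_bot _.
exact: (@star_ge1 D0).
Qed.

Lemma core_neq_top a : core a -> a <> ⊤.
Proof.
by move=> [_ /star_neq_bot_le_ff h] e; apply: top_nle_ff; rewrite -e.
Qed.

(** The product [a · b] is again in the core, hence below [ff]. *)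
Lemma core_le_neg a b : core a -> core b -> a ≤ ¬ b.
Proof.
move=> ca cb; apply/mul_le_ff; apply: star_neq_bot_le_ff.
by case: (core_mul ca cb).
Qed.

Lemma core_neq_neg a b : core a -> core b -> a <> ¬ b.
Proof. by move=> [_ sa] [_ sb] e; apply: sa; rewrite e; apply: star_neg_bot. Qed.

(** Otherwise [imp (¬ a) b] is not [⊥], and its product with [star b] is an element other than [⊥]
    below [star (¬ a)], against [star_neg_bot]. *)
Lemma core_mul_neg a b : core a -> core b -> ¬ a · ¬ b = ⊤.
Proof.
move=> [_ sa] [_ sb]; apply: NNPP => h.
have c0 : imp (¬ a) b <> ⊥ by move/neg_inj.
apply: (neq_bot_le (mul_neq_bot c0 sb) _ (star_neg_bot sa)).
apply/(impP (¬ a)); rewrite mulA; apply: le_tr (@res_mp D0 b 𝐞).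
by apply: (@le_mul D0) (lexx _); apply: (@res_mp D0).
Qed.

Definition gsm_core (a : D0) : Prop := core a /\ sugihara a.

Lemma gsm_core_mul a b : gsm_core a -> gsm_core b -> gsm_core (a · b).
Proof.
by move=> [ca sa] [cb sb]; split; [apply: core_mul | apply: sugihara_mul].
Qed.

Lemma gsm_core_meet a b : gsm_core a -> gsm_core b -> gsm_core (a ∧ b).
Proof. by case: (chain_meet tot a b) => ->. Qed.

Lemma gsm_core_join a b : gsm_core a -> gsm_core b -> gsm_core (a ∨ b).
Proof. by case: (chain_join tot a b) => ->. Qed.

Lemma gsm_core_res (a b : D0) : gsm_core a -> gsm_core b -> gsm_core (a ⇒ b).
Proof.
by move=> [ca sa] [cb sb]; split; [apply: core_imp | apply: sugihara_res].
Qed.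

Lemma gsm_core_negative a : a <> ⊥ -> a ≤ 𝐞 -> gsm_core a.
Proof.
by move=> a0 a1; split; [apply: core_negative | apply: sugihara_negative].
Qed.

Definition coreRL : RL := @sub_rl D0 gsm_core gsm_core_mul gsm_core_meet
  gsm_core_join gsm_core_res (gsm_core_negative one_neq_bot (lexx _)).

Lemma coreRL_totally_ordered : totally_ordered coreRL.
Proof. exact: sub_totally_ordered. Qed.

Lemma coreRL_GSM : generalized_Sugihara_monoid coreRL.
Proof.
split; first exact: chain_rl_semilinear coreRL_totally_ordered.
  by move=> [a [ca [aa sa]]]; apply: sval_inj.
move=> x; apply: sval_inj; case: (svalP (x ∨ 𝐞)) => _ [_].
by apply; apply: leUr.
Qed.

(** * The embedding of the reflection into the chain *)

Definition of_refl (x : reflection coreRL) : B :=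
  match x with
  | Rbot => ⊥
  | Rtop => ⊤
  | Rin a => sval a
  | Rpr a => ¬ sval a
  end.

Lemma of_refl_neg : {morph of_refl : x / ¬ x}.
Proof. by case=> [||a|a] //=; rewrite negK. Qed.

Lemma of_refl_bot (x : reflection coreRL) : of_refl x = ⊥ -> x = Rbot _.
Proof.
case: x => [||[a [ca sa]]|[a [ca sa]]] //= h.
- by case: top_neq_bot.
- by case: ca.
- by case: (core_neq_top ca); apply: neg_inj.
Qed.

Lemma of_refl_inj : injective of_refl.
Proof.
move=> x y xy; case: x y xy => [||a|a] y.
- by move/esym/of_refl_bot.
- move=> h; have /of_refl_bot : of_refl (¬ y) = ⊥ by rewrite of_refl_neg -h.
  by case: y h.
- case: y => [||b|b] h; first exact: of_refl_bot h.
  + by case: (core_neq_top (proj1 (svalP a))).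
  + by congr Rin; apply: sval_inj.
  + by case: (core_neq_neg (proj1 (svalP a)) (proj1 (svalP b))).
- case: y => [||b|b] h; first exact: of_refl_bot h.
  + by case: (proj1 (proj1 (svalP a))); apply: neg_inj; rewrite negK.
  + by case: (core_neq_neg (proj1 (svalP b)) (proj1 (svalP a))).
  + by congr Rpr; apply: sval_inj; apply: neg_inj.
Qed.

Lemma of_refl_mul : {morph of_refl : x y / x · y}.
Proof.
have topM (x : reflection coreRL) : x <> Rbot _ -> ⊤ · of_refl x = ⊤.
  by move=> x0; apply: mul_top => /of_refl_bot.
case=> [||a|a] [||b|b] //=; rewrite ?mul_bot // ?(mulC _ ⊥) ?mul_bot //.
- by rewrite (topM (Rtop _)).
- by rewrite (topM (Rin b)).
- by rewrite (topM (Rpr b)).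
- by rewrite mulC (topM (Rin a)).
- by rewrite /imp negK.
- by rewrite mulC (topM (Rpr a)).
- by rewrite /imp negK mulC.
- by rewrite core_mul_neg //; [case: (svalP a) | case: (svalP b)].
Qed.

Lemma neg_join x y : ¬ (x ∨ y) = ¬ x ∧ ¬ y.
Proof.
by case: (tot x y) => h; rewrite (le_join h) (le_meet (le_neg h)).
Qed.

Lemma of_refl_meet : {morph of_refl : x y / x ∧ y}.
Proof.
have cle (a b : coreRL) : sval a ≤ ¬ sval b.
  by apply: core_le_neg; [case: (svalP a) | case: (svalP b)].
case=> [||a|a] [||b|b] //=.
all: try by rewrite (le_meet (bot_le _)).
all: try by rewrite (le_meet (hai _)).
all: try by rewrite (le_meet (cle _ _)).
exact: neg_join.
Qed.

Lemma of_refl_join : {morph of_refl : x y / x ∨ y}.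
Proof.
move=> x y; apply: neg_inj; rewrite neg_join -!of_refl_neg -of_refl_meet.
(* De Morgan's law holds in the reflection by computation on constructors. *)
by congr of_refl; case: x y => [||a|a] [||b|b].
Qed.

Lemma of_refl_morphism : irl_morphism of_refl.
Proof.
split; last exact: of_refl_neg.
by split; [exact: of_refl_mul | exact: of_refl_meet | exact: of_refl_join |].
Qed.

Lemma of_refl_surj :
  negatively_generated B -> forall b, exists x : reflection coreRL, of_refl x = b.
Proof.
move=> gen; apply: gen.
  split=> [_ _ [x <-] [y <-]|_ _ [x <-] [y <-]|_ _ [x <-] [y <-]|_ [x <-]|].
  - by exists (x · y); rewrite of_refl_mul.
  - by exists (x ∧ y); rewrite of_refl_meet.
  - by exists (x ∨ y); rewrite of_refl_join.
  - by exists (¬ x); rewrite of_refl_neg.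
  - by exists 𝐞.
move=> a a1; case: (classic (a = ⊥)) => [->|a0]; first by exists (Rbot _).
by exists (Rin (exist _ a (gsm_core_negative a0 a1) : coreRL)).
Qed.

End Chain.

(** * Morphisms and quotients *)

Lemma irl_morphism_inv (A B : IRL) (g : A -> B) (h : B -> A) :
  irl_morphism g -> cancel g h -> cancel h g -> irl_morphism h.
Proof.
move=> [[gM gI gU g1] gN] gK hK; split.
  split=> [x y|x y|x y|].
  - by apply: (can_inj gK); rewrite gM !hK.
  - by apply: (can_inj gK); rewrite gI !hK.
  - by apply: (can_inj gK); rewrite gU !hK.
  - by rewrite -g1 gK.
by move=> x; apply: (can_inj gK); rewrite gN !hK.
Qed.

Lemma irl_morphism_comp (A B C : IRL) (g : A -> B) (h : B -> C) :
  irl_morphism g -> irl_morphism h -> irl_morphism (fun x => h (g x)).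
Proof.
move=> [[gM gI gU g1] gN] [[hM hI hU h1] hN]; split.
  split=> [x y|x y|x y|].
  - by rewrite gM hM.
  - by rewrite gI hI.
  - by rewrite gU hU.
  - by rewrite g1 h1.
by move=> x; rewrite gN hN.
Qed.

Section Quotient.
Variables (A B : IRL) (h : A -> B).
Hypotheses (hm : irl_morphism h) (hs : forall b, exists x, h x = b).

Lemma morph_le x y : x ≤ y -> h x ≤ h y.
Proof. by case: hm => [[_ hI _ _] _] xy; rewrite /le -hI xy. Qed.

Lemma square_increasing_quotient : square_increasing A -> square_increasing B.
Proof.
move=> sq b; case: (hs b) => x <-; case: hm => [[hM _ _ _] _].
by rewrite -hM; apply: morph_le.
Qed.

Lemma morph_ff2 : h ff2 = ff2.
Proof. by case: hm => [[hM _ _ h1] hN]; rewrite /ff2 hM /ff hN h1. Qed.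

Lemma anti_idempotent_quotient : anti_idempotent A -> anti_idempotent B.
Proof.
by move=> ai b; case: (hs b) => x <-; rewrite -morph_ff2; apply: morph_le.
Qed.

Lemma negatively_generated_quotient :
  negatively_generated A -> negatively_generated B.
Proof.
move=> gen S [SM SI SU SN S1] Sneg b; case: (hs b) => x <-.
move: x; case: (hm) => [[hM hI hU h1] hN]; apply: gen; first split.
- by move=> x y Sx Sy; rewrite hM; apply: SM.
- by move=> x y Sx Sy; rewrite hI; apply: SI.
- by move=> x y Sx Sy; rewrite hU; apply: SU.
- by move=> x Sx; rewrite hN; apply: SN.
- by rewrite h1.
- by move=> x /morph_le; rewrite h1; apply: Sneg.
Qed.

End Quotient.

(** * From negative generation to reflections *)

Lemma negatively_generated_chain (B : IRL) :
  totally_ordered B -> square_increasing B -> anti_idempotent B ->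
  nontrivial B -> negatively_generated B ->
  exists (D : RL) (g : B -> reflection D),
    [/\ generalized_Sugihara_monoid D, totally_ordered D, irl_morphism g
      & bijective g].
Proof.
move=> tot sqi hai hnt gen.
pose f := @of_refl B tot sqi hai hnt.
have fs b : {x | f x = b}.
  by apply: constructive_indefinite_description; apply: of_refl_surj.
pose g b := sval (fs b); have fg : cancel g f := fun b => svalP (fs b).
have gf : cancel f g := inj_can_sym fg (@of_refl_inj _ tot sqi hai hnt).
exists (coreRL tot sqi hai hnt), g; split; last by exists f.
- exact: coreRL_GSM.
- exact: coreRL_totally_ordered.
- exact: irl_morphism_inv (@of_refl_morphism _ tot sqi hai hnt) gf fg.
Qed.

Lemma negatively_generated_subdirect (A : IRL) :
  square_increasing A -> anti_idempotent A -> irl_semilinear A ->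
  negatively_generated A -> irl_subdirect refl_of_GSM_chain A.
Proof.
move=> sqi hai [I [B [h [tot hinj hm hs]]]] gen.
(* A reflection is never trivial, so trivial factors are discarded. Injectivity survives because any
   two elements agree in a trivial coordinate. *)
pose J := {i : I | nontrivial (B i)}.
have ex (j : J) : {D : RL & {g : B (sval j) -> reflection D |
    [/\ generalized_Sugihara_monoid D, totally_ordered D, irl_morphism g
      & bijective g]}}.
  have /constructive_indefinite_description
      [D /constructive_indefinite_description gP] :=
    negatively_generated_chain (tot (sval j))
      (square_increasing_quotient (hm _) (hs _) sqi)
      (anti_idempotent_quotient (hm _) (hs _) hai) (svalP j)
      (negatively_generated_quotient (hm _) (hs _) gen).
  by exists D.
pose g j := sval (projT2 (ex j)); have gP j := svalP (projT2 (ex j)).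
exists J, (fun j => reflection (projT1 (ex j))), (fun x j => g j (h x (sval j))).
split=> [j|x y xy|j|j b].
- by case: (gP j) => gsm Dtot _ _; exists (projT1 (ex j)).
- apply: hinj; apply: functional_extensionality_dep => i.
  case: (classic (nontrivial (B i))) => [nt|triv]; last first.
    by apply: NNPP => ne; apply: triv; exists (h x i), (h y i).
  have [_ _ _ /bij_inj] := gP (exist _ i nt); apply.
  exact: (congr1 (fun F => F (exist _ i nt)) xy).
- by case: (gP j) => _ _ gm _; apply: irl_morphism_comp gm.
- case: (gP j) => _ _ _ [k _ kK]; case: (hs (sval j) (k b)) => x hx.
  by exists x; rewrite hx; apply: kK.
Qed.

(** * The equation and its evaluation in reflections *)

Section NormalForm.
Variable A : IRL.
Implicit Type x : A.

Definition normal_form x : A :=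
  ((d (sigma x) ∧ sigma x) ∨ (d' (sigma' x) ∧ sigma' x))
    ∨ imp (ff2 ∨ ¬ ff2) (sigma' x).

Lemma normal_form_negatively_generated :
  (forall x, x = normal_form x) -> negatively_generated A.
Proof.
move=> nf S [SM SI SU SN S1] Sneg x.
have Simp y z : S y -> S z -> S (imp y z).
  by move=> Sy Sz; apply: (SN); apply: SM => //; apply: SN.
have Sff : S ff by apply: SN.
have Sff2 : S ff2 by apply: SM.
have Ssig y : S (sigma y).
  apply: SM; first by apply: Sneg; apply: leIr.
  by apply: Simp => //; apply: Sneg; apply: leIr.
have Ssig' y : S (sigma' y) by apply: SN.
have Sd' y : S y -> S (d' y) by move=> Sy; apply: SI; auto.
rewrite (nf x); apply: (SU); last by auto.
by apply: SU; apply: SI => //; apply: Sd' => //; apply: SN.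
Qed.

End NormalForm.

Lemma morph_normal_form (A B : IRL) (h : A -> B) :
  irl_morphism h -> {morph h : x / normal_form x}.
Proof.
move=> [[hM hI hU h1] hN].
have hff : h ff = ff by rewrite /ff hN h1.
have hff2 : h ff2 = ff2 by rewrite /ff2 hM hff.
have himp x y : h (imp x y) = imp (h x) (h y) by rewrite /imp !(hN, hM).
have hsig x : h (sigma x) = sigma (h x).
  by rewrite /sigma /star !(hM, himp, hI, h1).
have hsig' x : h (sigma' x) = sigma' (h x) by rewrite /sigma' hN hsig hN.
have hd' x : h (d' x) = d' (h x).
  by rewrite /d' hI himp hff2 !hM hN hff -/ff2.
have hd x : h (d x) = d (h x) by rewrite /d hd' hN.
by move=> x; rewrite /normal_form !(hU, hI, himp, hd, hd', hsig, hsig', hff2, hN).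
Qed.

(** For [a ≤ 𝐞] the second factor is [𝐞]; for [𝐞 ≤ a] the first is [𝐞] and the second is the double
    star of [a]. *)
Lemma GSM_chain_sigma (D : RL) (a : D) :
  generalized_Sugihara_monoid D -> totally_ordered D ->
  (a ∧ 𝐞) · rl_star (rl_star a ∧ 𝐞) = a.
Proof.
move=> [_ _ ss] tot; case: (tot a 𝐞) => a1.
  by rewrite (le_meet a1) (le_meet (star_ge1 a1)) star_one mulr1.
rewrite (le_meet a1) (le_meet (star_le1 a1)) mul1.
by have := ss a; rewrite (le_join a1).
Qed.

Lemma reflection_normal_form (D : RL) (x : reflection D) :
  generalized_Sugihara_monoid D -> totally_ordered D -> x = normal_form x.
Proof.
move=> gsm tot; have sig (a : D) := GSM_chain_sigma a gsm tot.
(* At [Rbot] and [Rtop] both sides compute. At [Rin a], [sigma'] gives [Rbot] and [d] gives [Rtop];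
   at [Rpr a], [sigma] gives [Rtop], which [d] sends to [Rbot], while [d'] gives [Rtop]. The last
   joinand is [Rbot] except at [Rtop]. *)
case: x => [||a|a] //; rewrite /normal_form.
  have -> : sigma (Rin a : reflection D) = Rin a by congr Rin; apply: sig.
  by [].
have -> : sigma' (Rpr a : reflection D) = Rpr a by congr Rpr; apply: sig.
by [].
Qed.

Lemma subdirect_normal_form (A : IRL) :
  irl_subdirect refl_of_GSM_chain A -> forall x : A, x = normal_form x.
Proof.
move=> [I [B [h [hK hinj hm _]]]] x; apply: hinj.
apply: functional_extensionality_dep => i; rewrite (morph_normal_form (hm i)).
move: (h x i); case: (hK i) => D [gsm tot ->] y; exact: reflection_normal_form.
Qed.

Theorem theorem7p11 (A : IRL) (hA : De_Morgan_monoid A)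
    (hnt : nontrivial A) (hai : anti_idempotent A) (hsl : irl_semilinear A) :
  (negatively_generated A <-> irl_subdirect refl_of_GSM_chain A)
  /\
  (irl_subdirect refl_of_GSM_chain A <->
     forall x : A,
       x = ((d (sigma x) ∧ sigma x) ∨ (d' (sigma' x) ∧ sigma' x))
             ∨ imp (ff2 ∨ ¬ ff2) (sigma' x)).
Proof.
have h12 := negatively_generated_subdirect (proj2 hA) hai hsl.
have h23 := @subdirect_normal_form A.
have h31 := @normal_form_negatively_generated A.
by split; split; auto.
Qed.
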